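(* Consider discretizations of an integral equation with elliptic kernel on a 2D domain $\Omega\subset\mathbb{R}^2$, with $N$ degrees of freedom and a quadtree with levels $0,\dots,L$, $L=\mathcal{O}(\log N)$. Assume that the number of skeletons for a box at level $\ell$, $k_\ell$, grows like $\mathcal{O}(L-\ell)$ as one moves up the tree (i.e. $k_\ell\le c\,(1+L-\ell)$ with $c$ independent of $N$ and $\ell$), in the hierarchical interpolative factorizations of both $G$ and $\bar G$. Suppose that the hierarchical interpolative factorization of $G$ is given, and that $\bar G$ differs from $G$ only through a collection of $m$ leaf boxes on level $L$, i.e. $\bar G(\mathcal{I},\mathcal{I}')=G(\mathcal{I},\mathcal{I}')$ for all index sets $\mathcal{I},\mathcal{I}'$ disjoint from the union of the sets $\mathcal{I}_b$ over these $m$ boxes $b$. Then constructing the hierarchical interpolative factorization of $\bar G$ by the updating algorithm described in the context, from the given factorization of $G$, has complexity $\mathcal{O}(m\log^4 N)$.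
   Context: **Setting.** $G\in\mathbb{C}^{N\times N}$ discretizes (e.g. by collocation at points $x_1,\dots,x_N$) an integral equation $a(x)u(x)+b(x)\int_\Omega K(x,y)c(y)u(y)\,dy=f(x)$, $x\in\Omega$, where $K$ is associated with an elliptic partial differential equation (its Green's function or a derivative of it). $\bar G\in\mathbb{C}^{N\times N}$ discretizes a perturbed problem with the same number of DOFs and the same tree. Write $[N]=\{1,\dots,N\}$, and let $A(\mathcal{I},\mathcal{I}')$ denote the submatrix with rows $\mathcal{I}$ and columns $\mathcal{I}'$. Overbars denote quantities for $\bar G$. **Tree.** A square containing the domain is the root (level $0$) of an adaptive quadtree with levels $0,\dots,L$, $L=\mathcal{O}(\log N)$; leaf boxes contain at most $n_{\rm occ}$ DOFs, with $n_{\rm occ}$ independent of $N$; all level-$L$ boxes are leaves. For a box $b$, $\mathrm{child}(b)$ is its set of children and $\mathrm{edge}(b)$ its set of four edges. **Interpolative decomposition (ID).** An $\epsilon$-accurate ID of a matrix $A$ with columns indexed by $\mathcal{I}$ is a partition $\mathcal{I}=\mathcal{S}\cup\mathcal{R}$ (skeleton and redundant columns) and a matrix $T$ with $A(:,\mathcal{R})=A(:,\mathcal{S})T+E$, $\|E\|_2\le\epsilon\|A\|_2$. **Skeletonization of $A$ with respect to $\mathcal{I}$.** With $\mathcal{I}^c$ the complement of $\mathcal{I}$, compute an ID ($\mathcal{S},\mathcal{R},T$) of $A(\mathcal{I}^c,\mathcal{I})$ stacked on $A(\mathcal{I},\mathcal{I}^c)^*$. Ordering the indices as $(\mathcal{I}^c,\mathcal{S},\mathcal{R})$,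 let $Q$ be the identity with additional $(\mathcal{S},\mathcal{R})$ block $-T$, and (neglecting the ID error) let $D_{\mathcal{S},\mathcal{R}},D_{\mathcal{R},\mathcal{S}},D_{\mathcal{R},\mathcal{R}}$ be the corresponding blocks of $Q^*AQ$, with $D_{\mathcal{R},\mathcal{R}}$ assumed nonsingular. Block elimination of $\mathcal{R}$ gives $D_{\mathcal{S},\mathcal{S}}=A(\mathcal{S},\mathcal{S})-D_{\mathcal{S},\mathcal{R}}D_{\mathcal{R},\mathcal{R}}^{-1}D_{\mathcal{R},\mathcal{S}}$ and matrices $U_{\mathcal{I}},V_{\mathcal{I}}$ (products of block unit-triangular matrices: $Q$ times the elimination matrices) such that $U_{\mathcal{I}}^*AV_{\mathcal{I}}$ is approximately $A$ with the $(\mathcal{S},\mathcal{S})$ and $(\mathcal{R},\mathcal{R})$ blocks replaced by $D_{\mathcal{S},\mathcal{S}},D_{\mathcal{R},\mathcal{R}}$ and all other blocks involving $\mathcal{R}$ replaced by zero. The DOFs in $\mathcal{R}$ become inactive; the DOFs in $\mathcal{S}$ remain active. **Levels of the hierarchical interpolative factorization.** Integer levels $\ell$ consist of boxes; half-integer levels $\ell-\tfrac12$ consist of the edges of boxes on level $\ell$. At level $\ell-\tfrac12$ the plane is divided by the Voronoi tessellation about the centers of these edges; $\mathcal{V}_e$ is the set of DOFs in the cell of edge $e$. DOF sets: for a leaf box $b$, $\mathcal{I}_b$ is the set of DOFs located in $b$ (those that are active); for a non-leaf box $b$, $\mathcal{I}_b=\bigcup_{b'\in\mathrm{child}(b),\,e\in\mathrm{edge}(b')}(\mathcal{S}_{b'}\cap\mathcal{S}_e)$,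 i.e. the DOFs of the children of $b$ still active after the box and edge skeletonizations; for an edge $e$ at level $\ell-\tfrac12$, $\mathcal{I}_e$ is the set of active DOFs in $\mathcal{V}_e$ belonging to the boxes adjacent to $e$ (i.e. those in $\mathcal{S}_b$ for level-$\ell$ boxes $b$ with $e\in\mathrm{edge}(b)$, and those in $\mathcal{I}_{b'}$ for adjacent childless boxes $b'$ on coarser levels). $\mathscr{L}_\ell$ and $\mathscr{L}_{\ell-1/2}$ are the collections of all DOF sets of boxes on level $\ell$, respectively of edges on level $\ell-\tfrac12$. For a box or edge $c$, far interactions in the ID are replaced by interactions with a bounded number of points on a proxy surface around $c$, of size a fixed multiple of the box width at that level; $\mathcal{N}_c$ denotes the active DOFs not in $\mathcal{I}_c$ located inside the proxy surface. For a box, only the boxes immediately adjacent to it meet the interior of the proxy surface. Skeletonizing $c$ uses only the entries of the current matrix with indices in $\mathcal{I}_c\cup\mathcal{N}_c$. **Factorization.** Set $G_L=G$. For $\ell=L,\dots,1$: skeletonize $G_\ell$ independently with respect to all sets in $\mathscr{L}_\ell$; form $G_{\ell-1/2}$ from $G_\ell$ by zeroing the rows and columns $\mathcal{R}_b$ and then setting the $(\mathcal{S}_b,\mathcal{S}_b)$ and $(\mathcal{R}_b,\mathcal{R}_b)$ blocks to $D_{\mathcal{S}_b,\mathcal{S}_b}$ and $D_{\mathcal{R}_b,\mathcal{R}_b}$; then skeletonize $G_{\ell-1/2}$ with respect to all sets in $\mathscr{L}_{\ell-1/2}$ and form $G_{\ell-1}$ from $G_{\ell-1/2}$ in the same way.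 With $U_{\mathscr{L}_j},V_{\mathscr{L}_j}$ the products of the $U_{\mathcal{I}},V_{\mathcal{I}}$ over $\mathcal{I}\in\mathscr{L}_j$, the factorization is $G\approx U_{\mathscr{L}_L}^{-*}U_{\mathscr{L}_{L-1/2}}^{-*}\cdots U_{\mathscr{L}_1}^{-*}U_{\mathscr{L}_{1/2}}^{-*}G_0V_{\mathscr{L}_{1/2}}^{-1}V_{\mathscr{L}_1}^{-1}\cdots V_{\mathscr{L}_{L-1/2}}^{-1}V_{\mathscr{L}_L}^{-1}$, stored in block form (the large matrices are never assembled). **Marked boxes and edges, updating algorithm.** Proceed through the levels $L,L-\tfrac12,L-1,\dots,1,\tfrac12$. A box or edge $c$ is marked if its skeletonization output may differ between the two problems, that is: if $G$ and $\bar G$ differ on an entry with indices in $\mathcal{I}_c\cup\mathcal{N}_c$, or if the index sets $\mathcal{I}_c,\mathcal{N}_c$, or an entry of the current matrix with indices in $\mathcal{I}_c\cup\mathcal{N}_c$, may have been altered by the skeletonization (choice of skeleton DOFs or Schur complement update of $(\mathcal{S},\mathcal{S})$ block) of a marked box or edge at an earlier-processed level. At each level determine the marked boxes or edges, recompute their skeletonization outputs for $\bar G$, and reuse for all other boxes or edges the stored outputs from the factorization of $G$. **Cost model.** $k_\ell$ is a bound, independent of the box, on the number of remaining skeleton DOFs for a box on level $\ell$ in either factorization. The cost of skeletonizing one box on level $\ell$, or one edge on the associated half-integer level $\ell-\tfrac12$, is dominated by the ID and is $\mathcal{O}(k_\ell^3)$ (with $k_\ell$ taken to be at least $1$). Complexity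 means the total cost of the skeletonizations recomputed by the updating algorithm. *)

(* Defs.v *)
From mathcomp Require Import all_boot all_order all_algebra.
From mathcomp Require Import complex.
From mathcomp Require Import boolp classical_sets reals exp.

Set Implicit Arguments.
Unset Strict Implicit.
Unset Printing Implicit Defensive.

Import Order.TTheory GRing.Theory Num.Theory.

Local Open Scope ring_scope.

(* [(l, i, j)] is the dyadic square of level [l] in column [i] and row [j],
   so that [(0, 0, 0)] is the root and (l, i, j) has parent (l-1, i/2, j/2). *)
Definition box : Type := (nat * nat * nat)%type.

(* [(true, (l, i, j))] is the bottom side and [(false, (l, i, j))] the left side
   of the square [(l, i, j)]; a side shared by two squares has one name. *)
Definition edge : Type := (bool * (nat * nat * nat))%type.

Definition cell : Type := (box + edge)%type.

Definition blev (b : box) : nat := b.1.1.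
Definition elev (e : edge) : nat := e.2.1.1.

(* An edge of level [l - 1/2] is recorded with the integer [l]. *)
Definition clev (c : cell) : nat :=
  match c with inl b => blev b | inr e => elev e end.

Definition parent (b : box) : box := ((blev b).-1, b.1.2./2, b.2./2).

Definition edges_of (b : box) : seq edge :=
  let: (l, i, j) := b in
  [:: (true, (l, i, j)); (true, (l, i, j.+1));
      (false, (l, i, j)); (false, (l, i.+1, j))].

Section Matrices.
Variable R : realType.
Local Notation C := (R[i]).

Definition l2norm n (v : 'cV[C]_n) : R :=
  Num.sqrt (\sum_i (complex.Re (v i 0) ^+ 2 + complex.Im (v i 0) ^+ 2)).

Definition spectral_norm m n (A : 'M[C]_(m, n)) : R :=
  sup (fun r : R => exists2 v : 'cV[C]_n, l2norm v <= 1 & r = l2norm (A *m v)).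

Definition adjoint m n (A : 'M[C]_(m, n)) : 'M[C]_(n, m) :=
  map_mx Num.conj A^T.

(* A submatrix is represented by the matrix of the original size that vanishes
   outside it; products, sums and spectral norms are unaffected. *)
Definition submat m n (I : {set 'I_m}) (J : {set 'I_n}) (A : 'M[C]_(m, n)) :
  'M[C]_(m, n) :=
  \matrix_(i, j) (if (i \in I) && (j \in J) then A i j else 0).

Definition colsubmat m n (J : {set 'I_n}) (A : 'M[C]_(m, n)) : 'M[C]_(m, n) :=
  submat [set: 'I_m] J A.

(* For square blocks [(K, K)]; completing the block by the identity outside
   [K] makes nonsingularity and inversion those of the block. *)
Definition pad1 n (K : {set 'I_n}) (A : 'M[C]_n) : 'M[C]_n :=
  submat K K A + submat (~: K) (~: K) 1%:M.

Definition nonsingular_block n (K : {set 'I_n}) (A : 'M[C]_n) : bool :=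
  pad1 K A \in unitmx.

Definition inv_block n (K : {set 'I_n}) (A : 'M[C]_n) : 'M[C]_n :=
  submat K K (invmx (pad1 K A)).

Definition interpolative_decomposition m n (eps : R) (A : 'M[C]_(m, n))
    (I S Rd : {set 'I_n}) (T : 'M[C]_n) : Prop :=
  [/\ S :|: Rd = I, [disjoint S & Rd], T = submat S Rd T &
      spectral_norm (colsubmat Rd A - colsubmat S A *m T)
        <= eps * spectral_norm (colsubmat I A)].

Record skel_output (N : nat) := SkelOutput {
  so_S : {set 'I_N};
  so_R : {set 'I_N};
  so_T : 'M[C]_N;
  so_DSS : 'M[C]_N;
  so_DRR : 'M[C]_N;
  so_U : 'M[C]_N;
  so_V : 'M[C]_N
}.

(* Interactions of [I] with the far field enter only through the rows of [P],
   which hold the (incoming and outgoing) interactions with proxy points. *)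
Definition id_matrix N p (A : 'M[C]_N) (I Nb : {set 'I_N}) (P : 'M[C]_(p, N)) :
  'M[C]_(N + N + p, N) :=
  col_mx (col_mx (submat Nb I A) (adjoint (submat I Nb A))) (colsubmat I P).

Definition skeletonizes N p (eps : R) (A : 'M[C]_N) (I Nb : {set 'I_N})
    (P : 'M[C]_(p, N)) (o : skel_output N) : Prop :=
  let S := so_S o in
  let Rd := so_R o in
  let Q := 1%:M - so_T o in
  let B := adjoint Q *m A *m Q in
  let DSR := submat S Rd B in
  let DRS := submat Rd S B in
  let DRRinv := inv_block Rd B in
  [/\ interpolative_decomposition eps (id_matrix A I Nb P) I S Rd (so_T o),
      so_DRR o = submat Rd Rd B /\ nonsingular_block Rd B,
      so_DSS o = submat S S A - DSR *m DRRinv *m DRS,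
      so_U o = Q *m adjoint (1%:M - DSR *m DRRinv) &
      so_V o = Q *m (1%:M - DRRinv *m DRS)].

Definition eliminate N (A : 'M[C]_N) (o : skel_output N) : 'M[C]_N :=
  \matrix_(i, j)
    (if (i \in so_S o) && (j \in so_S o) then so_DSS o i j
     else if (i \in so_R o) && (j \in so_R o) then so_DRR o i j
     else if (i \in so_R o) || (j \in so_R o) then 0
     else A i j).

End Matrices.

(* [voronoi l i] is the edge at level [l - 1/2] whose Voronoi cell contains the
   DOF [i], ties being broken in a prescribed way.  [proxy_region c] is the
   interior of the proxy surface around [c]. *)
Record setting (R : realType) (N : nat) := Setting {
  corner : R * R;
  side : R;
  depth : nat;
  boxes : seq box;
  pts : 'I_N -> R * R;
  voronoi : nat -> 'I_N -> edge;
  proxy_region : cell -> pred (R * R);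
  nproxy : cell -> nat;
  proxy_mx : forall c : cell, 'M[R[i]]_(nproxy c, N)
}.

Section Geometry.
Variables (R : realType) (N : nat) (st : setting R N).

Definition width (l : nat) : R := side st / 2 ^+ l.

(* Point with coordinates [(u, v)] in units of the level-[l] box width. *)
Definition grid_point (l : nat) (u v : R) : R * R :=
  ((corner st).1 + u * width l, (corner st).2 + v * width l).

(* Boxes are half-open, so that each level locates a point in one square. *)
Definition in_box (b : box) (p : R * R) : bool :=
  let: (l, i, j) := b in
  let lo := grid_point l i%:R j%:R in
  let hi := grid_point l i.+1%:R j.+1%:R in
  (lo.1 <= p.1 < hi.1) && (lo.2 <= p.2 < hi.2).

Definition in_closed_box (b : box) (p : R * R) : bool :=
  let: (l, i, j) := b in
  let lo := grid_point l i%:R j%:R in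
  let hi := grid_point l i.+1%:R j.+1%:R in
  (lo.1 <= p.1 <= hi.1) && (lo.2 <= p.2 <= hi.2).

Definition edge_ends (e : edge) : (R * R) * (R * R) :=
  let: (h, (l, i, j)) := e in
  (grid_point l i%:R j%:R,
   if h then grid_point l i.+1%:R j%:R else grid_point l i%:R j.+1%:R).

Definition cell_center (c : cell) : R * R :=
  match c with
  | inl (l, i, j) => grid_point l (i%:R + 2^-1) (j%:R + 2^-1)
  | inr (h, (l, i, j)) =>
      if h then grid_point l (i%:R + 2^-1) j%:R
      else grid_point l i%:R (j%:R + 2^-1)
  end.

Definition sqdist (p q : R * R) : R := (p.1 - q.1) ^+ 2 + (p.2 - q.2) ^+ 2.

Definition children (b : box) : seq box :=
  [seq b' <- boxes st | (blev b' == (blev b).+1) && (parent b' == b)].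

Definition is_leaf (b : box) : bool := children b == [::].

Definition dofs_in (b : box) : {set 'I_N} := [set i | in_box b (pts st i)].

Definition edges_at (l : nat) : seq edge :=
  undup (flatten [seq edges_of b | b <- boxes st & blev b == l]).

Definition adjacent_boxes (b b' : box) : Prop :=
  exists p, in_closed_box b p && in_closed_box b' p.

Definition coarse_adjacent (b : box) (e : edge) : bool :=
  [&& (blev b < elev e)%N, is_leaf b,
      in_closed_box b (edge_ends e).1 & in_closed_box b (edge_ends e).2].

Definition is_quadtree (n_occ : nat) : Prop :=
  [/\ 0 < side st, uniq (boxes st), (0, 0, 0)%N \in boxes st,
      forall b, b \in boxes st ->
        if blev b == 0%N then b == (0, 0, 0)%N else parent b \in boxes st &
      [/\ forall b, b \in boxes st -> (blev b <= depth st)%N,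
          exists2 b, b \in boxes st & blev b = depth st,
          forall i, in_box (0, 0, 0)%N (pts st i),
          (* empty children may be absent from the tree *)
          forall b i, b \in boxes st -> ~~ is_leaf b -> i \in dofs_in b ->
            exists2 b', b' \in children b & i \in dofs_in b' &
          forall b, b \in boxes st -> is_leaf b -> (#|dofs_in b| <= n_occ)%N]].

(* The last clause fixes ties: a DOF of a level-[l] box is attributed to one of
   the edges of that box, which are always among the nearest ones. *)
Definition is_voronoi : Prop :=
  forall l i, (0 < l <= depth st)%N ->
    [/\ voronoi st l i \in edges_at l,
        forall e, e \in edges_at l ->
          sqdist (pts st i) (cell_center (inr (voronoi st l i)))
            <= sqdist (pts st i) (cell_center (inr e)) &
        forall b, b \in boxes st -> blev b = l -> i \in dofs_in b ->
          voronoi st l i \in edges_of b].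

Definition voronoi_cell (e : edge) : {set 'I_N} :=
  [set i | voronoi st (elev e) i == e].

(* The cells that get skeletonized: levels L, L - 1/2, ..., 1, 1/2. *)
Definition cells : seq cell :=
  [seq inl b | b <- boxes st & (0 < blev b)%N] ++
  [seq inr e | e <- flatten [seq edges_at l | l <- iota 1 (depth st)]].

(* Position of the level of [c] in the order L, L - 1/2, L - 1, ..., 1/2. *)
Definition stage (c : cell) : nat :=
  match c with
  | inl b => (depth st - blev b).*2
  | inr e => (depth st - elev e).*2.+1
  end.

(* All DOFs that can belong to I_c, whatever skeletons were chosen before. *)
Definition region (c : cell) : {set 'I_N} :=
  match c with
  | inl b => dofs_in b
  | inr e =>
      voronoi_cell e :&:
        ((\bigcup_(b <- boxes st | (blev b == elev e) && (e \in edges_of b))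
            dofs_in b)
         :|: \bigcup_(b <- boxes st | coarse_adjacent b e) dofs_in b)
  end.

Definition enclosed (c : cell) : {set 'I_N} :=
  [set i | proxy_region st c (pts st i)].

(* A surface around [c] encloses the DOFs of [c].  For an edge this bounds the
   part of its Voronoi cell lying in coarse leaf boxes, as is needed for proxy
   points to stand for the far interactions of all of I_c. *)
Definition is_proxy (kappa : R) (n_proxy : nat) : Prop :=
  forall c, c \in cells ->
    [/\ region c \subset enclosed c,
        forall p, proxy_region st c p ->
          `|p.1 - (cell_center c).1| <= kappa * width (clev c) /\
          `|p.2 - (cell_center c).2| <= kappa * width (clev c),
        (nproxy st c <= n_proxy)%N &
        forall b b' p, c = inl b -> b' \in boxes st ->
          (blev b' == blev b) || ((blev b' < blev b)%N && is_leaf b') ->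
          proxy_region st c p -> in_box b' p -> adjacent_boxes b b'].

End Geometry.

Section Factorization.
Variables (R : realType) (N : nat) (st : setting R N) (eps : R).
Local Notation factors := (cell -> skel_output R N).

(* DOFs active when the level of index [t] starts being processed. *)
Definition active (F : factors) (t : nat) : {set 'I_N} :=
  ~: \bigcup_(c <- cells st | (stage st c < t)%N) so_R (F c).

Definition dof_set (F : factors) (c : cell) : {set 'I_N} :=
  match c with
  | inl b =>
      if is_leaf st b then active F (stage st c) :&: dofs_in st b
      else \bigcup_(b' <- children st b) \bigcup_(e <- edges_of b')
             (so_S (F (inl b')) :&: so_S (F (inr e)))
  | inr e =>
      voronoi_cell st e :&:
        ((\bigcup_(b <- boxes st | (blev b == elev e) && (e \in edges_of b))
            so_S (F (inl b)))
         :|: \bigcup_(b <- boxes st | coarse_adjacent st b e)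
            (active F (stage st c) :&: dofs_in st b))
  end.

Definition near_set (F : factors) (c : cell) : {set 'I_N} :=
  (active F (stage st c) :&: enclosed st c) :\: dof_set F c.

(* The current matrix: G_L, G_{L-1/2}, G_{L-1}, ... for t = 0, 1, 2, ... *)
Fixpoint current (F : factors) (G : 'M[R[i]]_N) (t : nat) : 'M[R[i]]_N :=
  if t is t'.+1 then
    foldl (fun A c => eliminate A (F c)) (current F G t')
      [seq c <- cells st | stage st c == t']
  else G.

Definition skeletonized (G : 'M[R[i]]_N) (F : factors) (c : cell) : Prop :=
  skeletonizes eps (current F G (stage st c)) (dof_set F c) (near_set F c)
    (proxy_mx st c) (F c).

Definition is_hif (G : 'M[R[i]]_N) (F : factors) : Prop :=
  forall c, c \in cells st -> skeletonized G F c.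

Variables (G Gbar : 'M[R[i]]_N) (F Fbar : factors).

(* Skeletonizing [c'] can only change the activity of the DOFs of its DOF set
   (in either factorization) and the matrix entries indexed by them. *)
Definition may_alter (c' c : cell) : Prop :=
  exists i, i \in dof_set F c' :|: dof_set Fbar c' /\
            i \in region st c :|: enclosed st c.

Inductive marked (c : cell) : Prop :=
| marked_entry i j of
    i \in dof_set F c :|: near_set F c & j \in dof_set F c :|: near_set F c &
    Gbar i j <> G i j
| marked_altered c' of
    c' \in cells st & (stage st c' < stage st c)%N & marked c' & may_alter c' c.

(* [Fbar] is obtained from the factorization [F] of [G] by the updating
   algorithm: marked cells are skeletonized anew for [Gbar], the stored outputs
   are reused for all the others. *)
Definition is_update : Prop :=
  forall c, c \in cells st ->
    (marked c -> skeletonized Gbar Fbar c) /\ (~ marked c -> Fbar c = F c).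

Definition update_cost (cost : cell -> R) : R :=
  \sum_(c <- cells st | `[< marked c >]) cost c.

Definition box_dofs (D : seq box) : {set 'I_N} :=
  \bigcup_(b <- D) dof_set F (inl b).

Definition differ_only_through (D : seq box) : Prop :=
  forall I I' : {set 'I_N},
    [disjoint I & box_dofs D] -> [disjoint I' & box_dofs D] ->
    submat I I' Gbar = submat I I' G.

End Factorization.

Definition skeleton_bound (R : realType) (N : nat) (st : setting R N)
    (F : cell -> skel_output R N) (k : nat -> nat) : Prop :=
  forall b, inl b \in cells st -> (#|so_S (F (inl b))| <= k (blev b))%N.

(* Main.v *)
(* A mark spreads from one cell to another only through a DOF enclosed by both
   proxy surfaces, hence over a distance proportional to the box width of the
   coarser cell.  Box widths double from level to level, so these distances sum
   geometrically: a marked cell of level l lies within a bounded multiple of the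
   level-l box width from one of the m modified leaves.  There are O(m) such
   cells on a level, so O(m L) in total, and each costs O(L^3). *)
Require Import Defs.
From mathcomp Require Import all_boot all_order all_algebra.
From mathcomp Require Import complex.
From mathcomp Require Import boolp classical_sets reals exp.
From mathcomp Require Import ring lra zify.

Import Order.TTheory GRing.Theory Num.Theory.

Local Open Scope ring_scope.


(** * Unions of finite sets indexed by sequences *)

Lemma in_bigcup_seqP {T : finType} {I : eqType} (s : seq I) (P : pred I)
    (A : I -> {set T}) (x : T) :
  reflect (exists i, [/\ i \in s, P i & x \in A i])
    (x \in \bigcup_(i <- s | P i) A i).
Proof.
rewrite (_ : (x \in _) = has (fun i => P i && (x \in A i)) s).
  apply: (iffP hasP) => [[i si /andP[Pi Ax]]|[i [si Pi Ax]]]; exists i => //.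
  by rewrite Pi.
elim: s => [|i s IHs]; first by rewrite big_nil inE.
by rewrite big_cons /= -IHs; case: (P i) => //=; rewrite finset.inE.
Qed.

Lemma bigcup_seq_subset {T : finType} {I : eqType} (s : seq I) (P : pred I)
    (A B : I -> {set T}) :
  (forall i, i \in s -> P i -> A i \subset B i) ->
  \bigcup_(i <- s | P i) A i \subset \bigcup_(i <- s | P i) B i.
Proof.
move=> sAB; apply/fintype.subsetP => x /in_bigcup_seqP[i [si Pi Ax]].
by apply/in_bigcup_seqP; exists i; split=> //;
  exact: (fintype.subsetP (sAB i si Pi)) x Ax.
Qed.

(** * Closeness in the sup norm and the arithmetic of radii *)

Definition sup_close {R : realType} (p q : R * R) (r : R) : Prop :=
  `|p.1 - q.1| <= r /\ `|p.2 - q.2| <= r.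

Lemma sup_closeC {R : realType} (p q : R * R) (r : R) :
  sup_close p q r -> sup_close q p r.
Proof. by rewrite /sup_close [`|q.1 - _|]distrC [`|q.2 - _|]distrC. Qed.

Lemma sup_close_trans {R : realType} (p q s : R * R) (r1 r2 : R) :
  sup_close p q r1 -> sup_close q s r2 -> sup_close p s (r1 + r2).
Proof.
by rewrite /sup_close !ler_norml => -[/andP[? ?] /andP[? ?]] [/andP[? ?] /andP[? ?]];
  split; apply/andP; split; lra.
Qed.

Lemma sup_close_le {R : realType} (p q : R * R) (r1 r2 : R) :
  r1 <= r2 -> sup_close p q r1 -> sup_close p q r2.
Proof. by move=> le12 [? ?]; split; apply: le_trans le12. Qed.

(** Serves a mark due to a differing entry: [k * w] reaches from the center of the cell to a DOF of
    a modified leaf, and [v] from that DOF to the center of the leaf. *)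
Lemma radius_base {R : realType} (k v w r : R) :
  0 <= k -> 0 < w -> v <= w -> 5 * k + 1 <= r -> k * w + v <= r * w.
Proof.
move=> k_ge0 w_gt0 le_vw; rewrite -(ler_pM2r w_gt0) => ler.
by have := mulr_ge0 k_ge0 (ltW w_gt0); lra.
Qed.

(** Serves a mark passed to a coarser level. The terms lead from the coarser center to a common DOF,
    on to the finer center, and on to the leaf. As [v <= w / 2], they sum to at most
    [k + (k + 7 * k + 1) / 2 = 5 * k + 1 / 2] widths [w]. *)
Lemma radius_up {R : realType} (k v w r s : R) :
  0 <= k -> 0 < v -> 2 * v <= w -> r <= 7 * k + 1 -> 5 * k + 1 <= s ->
  k * w + (k * v + r * v) <= s * w.
Proof.
move=> k_ge0 v_gt0 le_vw; have w_gt0 : 0 < w by lra.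
rewrite -(ler_pM2r v_gt0) => ler; rewrite -(ler_pM2r w_gt0) => les.
by have := ler_wpM2l k_ge0 le_vw; have := mulr_ge0 k_ge0 (ltW v_gt0); lra.
Qed.

(** * The dyadic grid: widths, nesting and centers of squares *)

Section Geometry.
Context {R : realType} {N : nat} (st : setting R N).

Lemma width_gt0 (l : nat) : 0 < side st -> 0 < width st l.
Proof. by move=> side_gt0; rewrite divr_gt0 ?exprn_gt0. Qed.

Lemma widthS (l : nat) : width st l = 2 * width st l.+1.
Proof. by rewrite /width exprSr invfM; field; rewrite expf_neq0 ?pnatr_eq0. Qed.

Lemma width_anti {l l' : nat} :
  0 < side st -> (l <= l')%N -> width st l' <= width st l.
Proof.
move=> side_gt0; elim: l' => [|l' IHl']; first by case: l.
rewrite leq_eqVlt => /predU1P[->//|/IHl'].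
by have := width_gt0 l'.+1 side_gt0; rewrite (widthS l'); lra.
Qed.

Lemma half_interval (i : nat) (c w x : R) :
  0 < w -> c + i%:R * w <= x < c + i.+1%:R * w ->
  c + i./2%:R * (2 * w) <= x < c + i./2.+1%:R * (2 * w).
Proof.
move=> w_gt0 /andP[lo hi].
have : (i./2 * 2)%:R * w <= i%:R * w :> R by rewrite ler_pM2r // ler_nat; lia.
have : i.+1%:R * w <= (i./2.+1 * 2)%:R * w :> R by rewrite ler_pM2r // ler_nat; lia.
by rewrite !natrM => le1 le2; apply/andP; split; lra.
Qed.

Lemma in_box_parent (b : box) (p : R * R) :
  0 < side st -> (0 < blev b)%N -> in_box st b p -> in_box st (parent b) p.
Proof.
case: b => [[[|l] i] j] // side_gt0 _ /andP[/= inx iny].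
by rewrite /in_box /= !(widthS l) !half_interval ?width_gt0.
Qed.

Lemma in_box_center (b : box) (p : R * R) :
  0 < side st -> in_box st b p ->
  sup_close p (cell_center st (inl b)) (width st (blev b)).
Proof.
case: b => [[l i] j] side_gt0 /andP[/= /andP[x1 x2] /andP[y1 y2]].
rewrite /sup_close /= /blev /= !ler_norml.
have w_gt0 := width_gt0 l side_gt0.
move: x2 y2; rewrite -[i.+1%:R]natr1 -[j.+1%:R]natr1 => x2 y2.
by split; apply/andP; split; lra.
Qed.

(** Offsets of leaf centers from the corner are thus nonnegative, where [Num.truncn] is a true
    floor. *)
Lemma center_ge_corner (b : box) : 0 < side st ->
  (corner st).1 <= (cell_center st (inl b)).1 /\
  (corner st).2 <= (cell_center st (inl b)).2.
Proof.
case: b => [[l i] j] /(width_gt0 l)/ltW w_ge0 /=.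
by split; rewrite lerDl mulr_ge0 ?addr_ge0 ?invr_ge0 ?ler0n.
Qed.

(** * Levels of cells and their processing order *)

Lemma edges_atP (l : nat) (e : edge) :
  reflect (exists b, [/\ b \in boxes st, blev b = l & e \in edges_of b])
    (e \in edges_at st l).
Proof.
rewrite mem_undup; apply: (iffP flatten_mapP) => [[b]|[b [sb bl eb]]].
  by rewrite mem_filter => /andP[/eqP bl sb] eb; exists b.
by exists b => //; rewrite mem_filter bl eqxx.
Qed.

Lemma elev_edges_of (b : box) (e : edge) : e \in edges_of b -> elev e = blev b.
Proof. by case: b => [[l i] j]; rewrite !inE => /or4P[] /eqP->. Qed.

Lemma elev_edges_at (l : nat) (e : edge) : e \in edges_at st l -> elev e = l.
Proof. by case/edges_atP=> b [_ <-]; apply: elev_edges_of. Qed.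

Lemma cells_inl (b : box) :
  (inl b \in cells st) = (b \in boxes st) && (0 < blev b)%N.
Proof.
rewrite mem_cat mem_map; last by move=> ? ? [].
rewrite mem_filter andbC [X in _ || X](_ : _ = false) ?orbF //.
by apply/mapP=> -[].
Qed.

Lemma cells_inr (e : edge) :
  (inr e \in cells st) = (e \in edges_at st (elev e)) && (0 < elev e <= depth st)%N.
Proof.
rewrite mem_cat mem_map; last by move=> ? ? [].
rewrite [X in X || _](_ : _ = false) /=; last by apply/mapP=> -[].
apply/flatten_mapP/andP => [[l]|[el le]].
  by rewrite mem_iota => le el; rewrite (elev_edges_at _ _ el); split=> //; lia.
by exists (elev e) => //; rewrite mem_iota; lia.
Qed.

Lemma cells_uniq : uniq (boxes st) -> uniq (cells st).
Proof.
move=> box_uniq; rewrite cat_uniq !map_inj_uniq ?filter_uniq //=; try by move=> ? ? [].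
apply/andP; split; first by apply/hasPn=> _ /mapP[e _ ->]; apply/mapP=> -[].
have: uniq (iota 1 (depth st)) := iota_uniq _ _.
elim: (iota _ _) => //= l s IHs /andP[s'l /IHs s_uniq].
rewrite cat_uniq undup_uniq s_uniq andbT /=.
apply/hasPn=> e /flatten_mapP[l' sl' el']; apply: contra s'l => el.
by rewrite -(elev_edges_at _ _ el) (elev_edges_at _ _ el').
Qed.

Lemma clev_cells (n_occ : nat) (c : cell) :
  is_quadtree st n_occ -> c \in cells st -> (0 < clev c <= depth st)%N.
Proof.
case=> _ _ _ _ [le_depth _ _ _ _]; case: c => [b|e].
  by rewrite cells_inl => /andP[/le_depth /= -> ->].
by rewrite cells_inr => /andP[].
Qed.

Lemma mem_children (b b' : box) :
  b' \in children st b ->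
  [/\ b' \in boxes st, blev b' = (blev b).+1 & parent b' = b].
Proof. by rewrite mem_filter => /andP[/andP[/eqP ? /eqP ?] ?]. Qed.

Lemma is_leaf_depth (b : box) :
  (forall b', b' \in boxes st -> (blev b' <= depth st)%N) ->
  blev b = depth st -> is_leaf st b.
Proof.
move=> le_depth bL; rewrite /is_leaf; case E: (children st b) => [//|b' s].
have [/le_depth b'L b'S _] := mem_children b b' ltac:(by rewrite E mem_head).
by move: b'L; rewrite b'S bL ltnn.
Qed.

(** The stage is twice the distance to the deepest level, plus one for an edge. The depth bounds
    keep the natural subtraction in it exact. *)
Lemma stage_lt (c' c : cell) :
  (clev c' <= depth st)%N -> (clev c <= depth st)%N -> (stage st c' < stage st c)%N ->
  (clev c < clev c')%N \/
  clev c' = clev c /\ exists b e, c' = inl b /\ c = inr e.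
Proof.
case: c' c => [b'|e'] [b|e] /= le' le lt_stage; try by left; lia.
have [|le_lev] := ltnP (elev e) (blev b'); first by left.
by right; split; [lia | exists b', e].
Qed.

(** * Counting the cells near a point *)

Definition nats_around (M a : nat) : seq nat := iota (a - M) (M.*2.+1).

(** One grid triple names a box, its bottom side and its left side, whence the factor 3 in the
    count. *)
Definition cell_shapes : seq (option bool) := [:: None; Some true; Some false].

Definition cell_of (f : option bool) (b : box) : cell :=
  if f is Some h then inr (h, b) else inl b.

(** Names are listed whether or not the tree contains them, so that the length depends on [M]
    alone. *)
Definition cells_around (M l : nat) (p : R * R) : seq cell :=
  let a := Num.truncn ((p.1 - (corner st).1) / width st l) in
  let b := Num.truncn ((p.2 - (corner st).2) / width st l) in
  [seq cell_of f (l, ij.1, ij.2)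
  | f <- cell_shapes,
    ij <- [seq (i, j) | i <- nats_around M a, j <- nats_around M b]].

Lemma size_cells_around (M l : nat) (p : R * R) :
  size (cells_around M l p) = (3 * (M.*2.+1 ^ 2))%N.
Proof. by rewrite !size_allpairs !size_iota. Qed.

(** [u] is a coordinate of a center in units of [w]. Replacing [u] by [i], the offset of [x] by its
    floor and [r] by its floor costs less than two units in all, which the margin [.+2] absorbs.
    Where the lower end of the list truncates at 0, the list only reaches further up. *)
Lemma mem_nats_around (i : nat) (x c w r u : R) :
  0 < w -> c <= x -> i%:R <= u <= i%:R + 2^-1 -> `|c + u * w - x| <= r * w ->
  i \in nats_around (Num.truncn r).+2 (Num.truncn ((x - c) / w)).
Proof.
move=> w_gt0 le_cx /andP[le_iu le_ui] dist; rewrite mem_iota.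
set y := (x - c) / w.
have xE : x = c + y * w by rewrite divfK ?gt_eqF // addrC subrK.
have y_ge0 : 0 <= y by rewrite divr_ge0 ?subr_ge0 // ltW.
have r_ge0 : 0 <= r by rewrite -(pmulr_lge0 _ w_gt0) (le_trans _ dist).
have {}dist : `|u - y| <= r.
  move: dist; rewrite xE (_ : _ - _ = (u - y) * w); last by ring.
  by rewrite normrM (gtr0_norm w_gt0) ler_pM2r.
have /andP[a1 a2] := Num.Theory.truncn_itv y_ge0.
have /andP[t1 t2] := Num.Theory.truncn_itv r_ge0.
move: dist; rewrite ler_norml => /andP[d1 d2].
set a := Num.truncn _ in a1 a2 *; set t := Num.truncn r in t1 t2 *.
have lt_i : (i < a.+1 + t.+1)%N by rewrite -(ltr_nat R) natrD; lra.
have lt_a : (a < i + t.+1 + 1)%N by rewrite -(ltr_nat R) !natrD; lra.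
by move: lt_i lt_a; clear; lia.
Qed.

Lemma mem_cells_around (c : cell) (p : R * R) (r : R) :
  0 < side st -> (corner st).1 <= p.1 -> (corner st).2 <= p.2 ->
  sup_close (cell_center st c) p (r * width st (clev c)) ->
  c \in cells_around (Num.truncn r).+2 (clev c) p.
Proof.
move=> side_gt0 le1 le2.
have w_gt0 := width_gt0 (clev c) side_gt0.
have half n : n%:R <= n%:R + 2^-1 :> R by lra.
have mem f l i j : f \in cell_shapes ->
    i \in nats_around (Num.truncn r).+2
      (Num.truncn ((p.1 - (corner st).1) / width st l)) ->
    j \in nats_around (Num.truncn r).+2
      (Num.truncn ((p.2 - (corner st).2) / width st l)) ->
    cell_of f (l, i, j) \in cells_around (Num.truncn r).+2 l p.
  move=> sf si sj.
  apply: (allpairs_f _ (y := (i, j)) sf).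
  exact: allpairs_f.
move: w_gt0; case: c => [[[l i] j]|[[] [[l i] j]]] w_gt0 /= [dx dy].
- by apply: (mem None) => //; [apply: mem_nats_around dx | apply: mem_nats_around dy];
  rewrite // ?lexx ?half.
- by apply: (mem (Some true)) => //; [apply: mem_nats_around dx | apply: mem_nats_around dy];
  rewrite // ?lexx ?half.
- by apply: (mem (Some false)) => //; [apply: mem_nats_around dx | apply: mem_nats_around dy];
  rewrite // ?lexx ?half.
Qed.


(** * Localization of DOF sets, whatever skeletons are chosen *)

Section Containment.
Variables (n_occ : nat) (kappa : R) (n_proxy : nat).
Hypotheses (tree : is_quadtree st n_occ) (proxy : is_proxy st kappa n_proxy).

Lemma enclosed_close (c : cell) (i : 'I_N) :
  c \in cells st -> i \in enclosed st c ->
  sup_close (pts st i) (cell_center st c) (`|kappa| * width st (clev c)).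
Proof.
case: tree => side_gt0 _ _ _ _; case/proxy=> _ bound _ _.
rewrite inE => /bound; apply: sup_close_le.
by rewrite ler_pM2r ?width_gt0 ?ler_norm.
Qed.

Section Skeletons.
Context {F : cell -> skel_output R N}.
(** The alternative covers both factorizations: a fresh output picks skeletons from the current DOF
    set of its cell, while a reused one picked them from the DOF set of the original factorization,
    which is only known to lie in the region. *)
Hypothesis skel_sub : forall c, c \in cells st ->
  so_S (F c) \subset dof_set st F c \/ so_S (F c) \subset region st c.

(** Induction from the deepest level upwards: active DOFs of a non-leaf box are skeletons of its
    children, and each child square lies in its parent. *)
Lemma dof_set_box_sub (b : box) :
  b \in boxes st -> dof_set st F (inl b) \subset dofs_in st b.
Proof.
case: tree => side_gt0 _ _ _ [le_depth _ _ _ _].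
have [n] := ubnP (depth st - blev b); elim: n b => // n IHn b ltn sb.
rewrite /dof_set; case: ifP => leaf_b; first exact: finset.subsetIr.
apply/fintype.subsetP=> i /in_bigcup_seqP[b' [child_b' _]].
have [sb' lev_b' par_b'] := mem_children _ _ child_b'.
case/in_bigcup_seqP=> e [_ _ /finset.setIP[Si _]].
have cell_b' : inl b' \in cells st by rewrite cells_inl sb' lev_b'.
have : i \in dofs_in st b'.
  have [sub|sub] := skel_sub _ cell_b'; last exact: (fintype.subsetP sub).
  apply: (fintype.subsetP (IHn b' _ sb')) (fintype.subsetP sub _ Si).
  by have := le_depth _ sb'; lia.
by rewrite !inE -[X in _ -> in_box _ X _]par_b' => /in_box_parent->; rewrite ?lev_b'.
Qed.

Lemma skel_box_sub (b : box) :
  inl b \in cells st -> so_S (F (inl b)) \subset dofs_in st b.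
Proof.
move=> cb; have [sub|//] := skel_sub _ cb.
apply: fintype.subset_trans sub (dof_set_box_sub b _).
by move: cb; rewrite cells_inl => /andP[].
Qed.

Lemma dof_set_sub_region (c : cell) :
  c \in cells st -> dof_set st F c \subset region st c.
Proof.
case: c => [b|e]; first by rewrite cells_inl => /andP[/dof_set_box_sub].
rewrite cells_inr => /andP[_ /andP[e_gt0 _]].
apply: finset.setIS; apply: finset.setUSS; apply: bigcup_seq_subset => b sb.
  by case/andP=> /eqP be _; apply: skel_box_sub; rewrite cells_inl sb be.
by move=> _; apply: finset.subsetIr.
Qed.

Lemma dof_set_sub_enclosed (c : cell) :
  c \in cells st -> dof_set st F c \subset enclosed st c.
Proof.
move=> cc; apply: fintype.subset_trans (dof_set_sub_region c cc) _.
by case: (proxy c cc).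
Qed.

End Skeletons.

(** * Spread and number of marked cells *)

Section Marking.
Variables (eps : R) (G Gbar : 'M[R[i]]_N) (F Fbar : cell -> skel_output R N).
Variable D : seq box.
Hypotheses (hif : is_hif st eps G F) (upd : is_update st eps G Gbar F Fbar).
Hypothesis D_leaves : forall b, b \in D -> b \in boxes st /\ blev b = depth st.
Hypothesis diffG : differ_only_through st G Gbar F D.

Lemma skeletonized_sub {H : 'M[R[i]]_N} {F' : cell -> skel_output R N} {c : cell} :
  skeletonized st eps H F' c -> so_S (F' c) \subset dof_set st F' c.
Proof. by case=> -[<- _ _ _] _ _ _ _; apply: finset.subsetUl. Qed.

Lemma hif_dof_set_sub (c : cell) :
  c \in cells st -> so_S (F c) \subset dof_set st F c \/ so_S (F c) \subset region st c.
Proof. by move=> cc; left; apply: skeletonized_sub (hif c cc). Qed.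

Lemma update_dof_set_sub (c : cell) : c \in cells st ->
  so_S (Fbar c) \subset dof_set st Fbar c \/ so_S (Fbar c) \subset region st c.
Proof.
move=> cc; have [redo reuse] := upd c cc.
have [/redo mc|/reuse ->] := pselect (marked st G Gbar F Fbar c).
  by left; apply: skeletonized_sub mc.
right; apply: fintype.subset_trans (skeletonized_sub (hif c cc)) _.
exact: dof_set_sub_region hif_dof_set_sub c cc.
Qed.

Lemma differing_entry (i j : 'I_N) :
  Gbar i j <> G i j -> i \in box_dofs st F D \/ j \in box_dofs st F D.
Proof.
move=> neq; have [|iD] := boolP (i \in _); first by left.
have [|jD] := boolP (j \in _); first by right.
(* Were both indices outside the modified leaves, singleton index sets would force the two entries
   to agree. *)
have := diffG [set i]%SET [set j]%SET; rewrite !finset.disjoints1.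
by move=> /(_ iD jD) /matrixP/(_ i j); rewrite !mxE !finset.set11.
Qed.

(** A modified box lies on the deepest level, hence is a leaf, and its DOFs are points located in
    it. *)
Lemma box_dofs_close (i : 'I_N) : i \in box_dofs st F D ->
  exists2 d, d \in D &
    sup_close (pts st i) (cell_center st (inl d)) (width st (depth st)).
Proof.
case: tree => side_gt0 _ _ _ [le_depth _ _ _ _].
case/in_bigcup_seqP=> d [dD _]; have [sd lev_d] := D_leaves d dD.
rewrite /dof_set is_leaf_depth // inE => /andP[_]; rewrite inE => i_d.
by exists d => //; rewrite -lev_d; apply: in_box_center.
Qed.

Lemma near_set_sub_enclosed (F' : cell -> skel_output R N) (c : cell) :
  near_set st F' c \subset enclosed st c.
Proof. by rewrite finset.subDset finset.subsetU // finset.subsetIr orbT. Qed.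

(* These radii are stable: from a box to an edge of the same level the distance
   grows by [2 |kappa|] box widths; going up a level, it is halved in units of the
   box width before [3 |kappa| / 2] is added, and [(7 + 3) / 2 = 5]. *)
Definition mark_radius (c : cell) : R :=
  (if c is inl _ then 5 else 7) * `|kappa| + 1.

Lemma mark_radius_bounds (c : cell) :
  5 * `|kappa| + 1 <= mark_radius c <= 7 * `|kappa| + 1.
Proof.
rewrite /mark_radius; have := normr_ge0 kappa.
by case: c => _; move: `|kappa| => K K_ge0; apply/andP; split; lra.
Qed.

(** Induction on the derivation of the mark, with the triangle inequality through one shared DOF at
    each step. *)
Lemma marked_close (c : cell) :
  marked st G Gbar F Fbar c -> c \in cells st ->
  exists2 d, d \in D &
    sup_close (cell_center st c) (cell_center st (inl d))
      (mark_radius c * width st (clev c)).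
Proof.
case: (tree) => side_gt0 _ _ _ [le_depth _ _ _ _].
have K_ge0 := normr_ge0 kappa.
have encl_region c' i : c' \in cells st ->
    i \in region st c' :|: enclosed st c' -> i \in enclosed st c'.
  move=> cc'; have [sub _ _ _] := proxy c' cc'.
  by rewrite finset.inE => /orP[/(fintype.subsetP sub)|].
elim=> {}c => [i j ic jc neq cc|c' cc' ltcc' _ IHc' [i [iI icE]] cc].
  have sub : dof_set st F c :|: near_set st F c \subset enclosed st c.
    rewrite finset.subUset near_set_sub_enclosed andbT.
    exact: dof_set_sub_enclosed hif_dof_set_sub c cc.
  (* One index of the differing entry belongs to a modified leaf, and both lie inside the proxy
     surface of [c]. *)
  have [x [xc xD]] : exists x, x \in enclosed st c /\ x \in box_dofs st F D.
    by case: (differing_entry _ _ neq) => ?;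
       [exists i | exists j]; split=> //; apply: (fintype.subsetP sub).
  have [d dD close_d] := box_dofs_close x xD; exists d => //.
  apply: sup_close_le (sup_close_trans _ _ _ _ _
    (sup_closeC _ _ _ (enclosed_close c x cc xc)) close_d).
  have /andP[_ cL] := clev_cells _ _ tree cc.
  have /andP[rad _] := mark_radius_bounds c.
  exact: radius_base (width_gt0 _ side_gt0) (width_anti side_gt0 cL) rad.
have [d dD close_d] := IHc' cc'; exists d => //.
(* The altered DOF may come from the DOF set of [c'] in either factorization, so containment is
   needed for both. *)
have ic' : i \in enclosed st c'.
  case/finset.setUP: iI; apply: fintype.subsetP.
    exact: dof_set_sub_enclosed hif_dof_set_sub c' cc'.
  exact: dof_set_sub_enclosed update_dof_set_sub c' cc'.
have {}icE := encl_region c i cc icE.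
apply: sup_close_le (sup_close_trans _ _ _ _ _
  (sup_closeC _ _ _ (enclosed_close c i cc icE))
  (sup_close_trans _ _ _ _ _ (enclosed_close c' i cc' ic') close_d)).
have /andP[_ cL] := clev_cells _ _ tree cc.
have /andP[_ c'L] := clev_cells _ _ tree cc'.
have [lt_lev|[eq_lev [b [e [c'E cE]]]]] := stage_lt _ _ c'L cL ltcc'.
  have /andP[rad _] := mark_radius_bounds c.
  have /andP[_ rad'] := mark_radius_bounds c'.
  have le_w := width_anti side_gt0 lt_lev.
  apply: radius_up (width_gt0 _ side_gt0) _ rad' rad => //.
  by rewrite (widthS (clev c)) ler_pM2l.
(* On equal levels the mark passes from a box to an edge and the widths agree, so the radius has to
   grow by exactly two proxy radii. *)
have -> : mark_radius c = mark_radius c' + 2 * `|kappa|.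
  by rewrite c'E cE /mark_radius; move: `|kappa| => K; ring.
by rewrite eq_lev; move: (width st _) (mark_radius c') `|kappa| => w r K; lra.
Qed.

(** The blocks around each modified leaf, one per level from 1 to the depth, together contain every
    marked cell, and the list of marked cells has no repetition. *)
Lemma size_marked_le :
  (size [seq c <- cells st | `[< marked st G Gbar F Fbar c >]]
   <= 3 * ((Num.truncn (7 * `|kappa| + 1)).+2.*2.+1 ^ 2) * (size D * depth st))%N.
Proof.
set M := (Num.truncn _).+2.
case: (tree) => side_gt0 box_uniq _ _ _.
pose T := flatten [seq cells_around M dl.2 (cell_center st (inl dl.1))
                  | dl <- [seq (d, l) | d <- D, l <- iota 1 (depth st)]].
have -> : (3 * (M.*2.+1 ^ 2) * (size D * depth st))%N = size T.
  rewrite size_flatten /shape -map_comp (eq_map (g := fun=> 3 * (M.*2.+1 ^ 2))%N).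
    by rewrite sumnE big_map big_const_seq iter_addn_0 count_predT size_allpairs size_iota.
  by move=> dl; apply: size_cells_around.
apply: uniq_leq_size; first by rewrite filter_uniq ?cells_uniq.
move=> c; rewrite mem_filter => /andP[/asboolP marked_c cc].
have [d dD close_d] := marked_close c marked_c cc.
have /andP[c_gt0 cL] := clev_cells _ _ tree cc.
apply/flatten_mapP; exists (d, clev c).
  by apply: allpairs_f => //; rewrite mem_iota; lia.
have [le1 le2] := center_ge_corner d side_gt0.
apply: mem_cells_around => //; apply: sup_close_le close_d.
(* The edge radius, the larger of the two, serves for all cells. *)
by rewrite ler_pM2r ?width_gt0 //; case/andP: (mark_radius_bounds c).
Qed.

End Marking.
End Containment.

End Geometry.

(** * The total cost of an update *)

Theorem theorem4p3 (R : realType) (n_occ n_proxy : nat)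
    (kappa c_L c_k c_cost : R) :
  exists Cst : R,
    forall (N : nat) (Omega : set (R * R)) (st : setting R N) (eps : R)
      (G Gbar : 'M[R[i]]_N) (F Fbar : cell -> skel_output R N)
      (D : seq box) (k : nat -> nat) (cost : cell -> R),
    (forall i, Omega (pts st i)) ->
    (forall p, Omega p -> in_box st (0, 0, 0)%N p) ->
    is_quadtree st n_occ ->
    is_voronoi st ->
    is_proxy st kappa n_proxy ->
    (depth st)%:R <= c_L * ln (N%:R : R) ->
    (forall l, (l <= depth st)%N ->
      (1 <= k l)%N /\ (k l)%:R <= c_k * (1 + (depth st - l)%:R)) ->
    (forall c, c \in cells st ->
      0 <= cost c <= c_cost * (k (clev c))%:R ^+ 3) ->
    is_hif st eps G F ->
    uniq D ->
    (forall b, b \in D -> b \in boxes st /\ blev b = depth st) ->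
    differ_only_through st G Gbar F D ->
    is_update st eps G Gbar F Fbar ->
    skeleton_bound st F k ->
    skeleton_bound st Fbar k ->
    update_cost st G Gbar F Fbar cost
      <= Cst * (size D)%:R * ln (N%:R : R) ^+ 4.
Proof.
pose n_around := (3 * ((Num.truncn (7 * `|kappa| + 1)).+2.*2.+1 ^ 2))%N.
(* Three factors [c_L] come from the cubic cost of one cell and the fourth from the number of
   levels. Absolute values make the other factors nonnegative. *)
exists (n_around%:R * (`|c_cost| * `|c_k| ^+ 3) * c_L ^+ 4).
move=> N Omega st eps G Gbar F Fbar D k cost _ _ tree _ proxy le_depth k_le cost_le.
move=> hif _ D_leaves diffG upd _ _.
have := size_marked_le _ _ _ _ tree proxy _ _ _ _ _ _ hif upd D_leaves diffG.
rewrite -/n_around; move: n_around => n_around; rewrite -(ler_nat R) !natrM => size_le.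
set a := `|c_cost| * `|c_k| ^+ 3.
have a_ge0 : 0 <= a by rewrite mulr_ge0 ?exprn_ge0.
have cost_le_depth c : c \in cells st -> cost c <= a * (depth st)%:R ^+ 3.
  move=> cc; have /andP[c_gt0 cL] := clev_cells _ _ _ tree cc.
  have /andP[_ /le_trans->//] := cost_le c cc; have [_ le_k] := k_le _ cL.
  rewrite -mulrA -exprMn; apply: le_trans (ler_wpM2r _ (ler_norm c_cost)) _.
    by rewrite exprn_ge0.
  apply: ler_wpM2l => //; rewrite lerXn2r ?nnegrE ?mulr_ge0 //.
  (* Skeletonized cells have level at least 1, so [1 + (depth st - clev c)] is at most the depth
     itself. *)
  apply: le_trans le_k _; rewrite nat1r.
  apply: le_trans (ler_wpM2r _ (ler_norm c_k)) _ => //.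
  by rewrite ler_wpM2l // ler_nat; move: c_gt0 cL; clear; lia.
rewrite /update_cost -big_filter big_seq.
apply: le_trans (ler_sum _ (G := fun=> a * (depth st)%:R ^+ 3) _) _.
  by move=> c; rewrite mem_filter => /andP[_ /cost_le_depth].
rewrite -big_seq big_const_seq count_predT iter_addr addr0 -[leLHS]mulr_natr.
apply: le_trans (ler_wpM2l _ size_le) _; first by rewrite mulr_ge0 ?exprn_ge0.
(* As an upper bound of the depth, [c_L * ln N] is nonnegative, so fourth powers preserve the
   inequality. *)
have depth4 : (depth st)%:R ^+ 4 <= (c_L * ln (N%:R : R)) ^+ 4.
  by rewrite lerXn2r ?nnegrE // (le_trans _ le_depth).
have := ler_wpM2l (mulr_ge0 (mulr_ge0 (ler0n R n_around) a_ge0) (ler0n R (size D))) depth4.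
move: n_around%:R (size D)%:R (depth st)%:R (ln _) => C m L x le4.
by lra.
Qed.
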